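(* Let $E$ be a real Banach space of dimension at least $2$, let $D\subsetneq E$ be a domain, let $P\subset D$ be a countable closed subset of $D$ such that $k_D(x,y)\ge \frac12$ for all distinct $x,y\in P$, and let $G=D\setminus P$. Then $D$ is a $c$-uniform domain if and only if $G$ is a $c_1$-uniform domain, where the constants $c$ and $c_1$ depend only on each other. That is: if $D$ is $c$-uniform, then $G$ is $c_1$-uniform for some constant $c_1$ depending only on $c$; and if $G$ is $c_1$-uniform, then $D$ is $c$-uniform for some constant $c$ depending only on $c_1$ (in particular, the dependence does not involve $E$, $D$ or $P$).
   Context: The norm of $z\in E$ is written $|z|$. A domain is a nonempty open connected set. For a domain $U\subsetneq E$, $d_U(z)$ denotes the distance from $z$ to the boundary $\partial U$ of $U$. The quasihyperbolic distance is $k_U(z_1,z_2)=\inf_\alpha \int_\alpha \frac{|dz|}{d_U(z)}$, the infimum being over all rectifiable arcs $\alpha$ in $U$ joining $z_1$ and $z_2$. A domain $U$ is called $c$-uniform, for a constant $c$, if each pair of points $z_1,z_2\in U$ can be joined by a rectifiable arc $\gamma$ in $U$ such that (1) $\min_{j=1,2}\ell(\gamma[z_j,z])\le c\,d_U(z)$ for all $z\in\gamma$, and (2) $\ell(\gamma)\le c|z_1-z_2|$; here $\ell(\gamma)$ is the arc length of $\gamma$ and $\gamma[z_j,z]$ is the part of $\gamma$ between $z_j$ and $z$. Countable means finite or countably infinite, and closed means relatively closed in $D$. *)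

(* Defs.v *)
From HB Require Import structures.
From mathcomp Require Import all_boot all_order all_algebra.
From mathcomp Require Import all_classical all_reals all_analysis.

Set Implicit Arguments.
Unset Strict Implicit.
Unset Printing Implicit Defensive.

Import Order.TTheory GRing.Theory Num.Theory.
Import numFieldNormedType.Exports.

Local Open Scope classical_set_scope.
Local Open Scope ring_scope.

Section Definitions.
Context {R : realType} {E : completeNormedModType R}.
Implicit Types (U : set E) (z : E) (a b c : R) (g : R -> E).

Definition dim_ge2 : Prop :=
  exists u v : E, forall x y : R, x *: u + y *: v = 0 -> x = 0 /\ y = 0.

(* d_U is only meaningful on a domain different from the whole space (otherwise
   the boundary is empty and [bdist U] is the junk value [inf set0 = 0]), so
   properness is part of the notion. *)
Definition proper_domain U : Prop :=
  [/\ U !=set0, open U, connected U & U != [set: E]].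

Definition boundary U : set E := closure U `\` interior U.

Definition bdist U z : R := inf [set `|z - w| | w in boundary U].

(* The library's [total_variation] is restricted to real-valued functions. *)
Definition arclength a b g : \bar R :=
  ereal_sup [set (\sum_(0 <= i < size s)
                    `|g (nth b (a :: s) i.+1) - g (nth b (a :: s) i)|)%:E
            | s in itv_partition a b].

(* A rectifiable arc in U from z1 to z2, given by an injective continuous
   parametrization on [a, b].  The case a = b (a single point) is allowed, so
   that z1 = z2 is covered. *)
Definition rectifiable_arc U z1 z2 a b g : Prop :=
  [/\ a <= b,
      {within `[a, b], continuous g},
      {in `[a, b] &, injective g},
      g @` `[a, b] `<=` U &
      [/\ g a = z1, g b = z2 & (arclength a b g < +oo)%E]].

(* The point of the curve g|[a, b] at arc length s from its initial point; it
   is unique when it exists, i.e. for 0 <= s <= arclength a b g when g is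
   continuous and rectifiable. *)
Definition arclength_param a b g (s : R) : E :=
  xget (g a) [set z | exists2 t, t \in `[a, b] &
                        arclength a t g = s%:E /\ g t = z].

(* The integral of rho against |dz| along g|[a, b]. *)
Definition line_integral (rho : E -> R) a b g : \bar R :=
  \int[lebesgue_measure]_(s in `[0, fine (arclength a b g)])
    (rho (arclength_param a b g s))%:E.

Definition qh_dist U z1 z2 : \bar R :=
  ereal_inf [set l | exists a b g,
    rectifiable_arc U z1 z2 a b g /\
    l = line_integral (fun z => (bdist U z)^-1) a b g].

Definition uniform_domain c U : Prop :=
  proper_domain U /\
  forall z1 z2, U z1 -> U z2 ->
    exists a b g,
      [/\ rectifiable_arc U z1 z2 a b g,
          forall t, t \in `[a, b] ->
            (mine (arclength a t g) (arclength t b g)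
               <= (c * bdist U (g t))%:E)%E &
          (arclength a b g <= (c * `|z1 - z2|)%:E)%E].

Definition relatively_closed U (P : set E) : Prop :=
  exists2 F : set E, closed F & P = U `&` F.

End Definitions.

Arguments dim_ge2 {R} E.

(* Main.v *)
Require Import Defs.
From HB Require Import structures.
From mathcomp Require Import all_boot all_order all_algebra.
From mathcomp Require Import all_classical all_reals all_analysis.
From mathcomp Require Import ring lra.

Set Implicit Arguments.
Unset Strict Implicit.
Unset Printing Implicit Defensive.

Import Order.TTheory GRing.Theory Num.Theory.
Import numFieldNormedType.Exports.

Local Open Scope classical_set_scope.
Local Open Scope ring_scope.

(** Both implications are instances of one construction.  Let [Q] be a closed
    subset of [D] whose points are separated on the scale of [d = bdist D], and
    suppose that any two points of [D `\` Q] can be joined, up to moving the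
    endpoints by a small multiple of [d], by a curve in [D] that is uniform with
    respect to [D].  Then [D `\` Q] is uniform, with a constant depending only on
    that of the curves ([uniform_of_near_curves]).  For [D] uniform one takes
    [Q = P] and the uniform arcs of [D]: the lower bound on [qh_dist] makes [P]
    separated, because nearby points are joined by a short segment of small
    quasihyperbolic length ([qh_dist_segment]).  For [D `\` P] uniform one takes
    [Q = set0]: a countable set has dense complement ([countable_not_near]), so
    points of [D], including those of [P], are approximated by points of
    [D `\` P], and a uniform arc of [D `\` P] is a fortiori one for [D].

    The construction replaces the given curve by a polygon that avoids [Q].
    Vertices are chosen along the curve at steps proportional to [d]; each is
    moved a little so that its distance to [Q] is comparable with [d]
    ([well_placed_exists]), and consecutive vertices are joined by a short
    polygon ([local_link]).  Near any point [x] of [D] there is at most one point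
    [p] of [Q], so the joining is a problem in the space punctured at [p], where
    it is solved by going through a vector transversal to the lines from [p] to
    both endpoints ([punctured_space_uniform], the only place where dimension one
    would not suffice).  Since a step of the curve has length at least its chord,
    which is a fixed multiple of [d], the joining polygons are no longer than a
    constant times the part of the curve that they replace, up to a multiple of
    [d] at its end ([chain]).

    A uniform domain asks for injective curves, and the resulting polygon may
    cross itself.  Loops are erased one segment at a time: before a segment is
    prepended to an arc it is cut at the last point where the arc meets it
    ([arc_prepend]).  What survives is described by [onpoly], which records the
    lengths of the polygon before and after each of its points; these dominate
    the lengths of the two parts of the arc, so estimates made on the polygon
    pass to the arc. *)

(** * Arc length of curves *)
Section ArcLength.
Context {R : realType} {E : completeNormedModType R}.
Implicit Types (a b c : R) (g : R -> E) (s : seq R).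

Fixpoint chords g a s : R :=
  if s is x :: s' then `|g x - g a| + chords g x s' else 0.

Lemma chords_sum g a b s :
  \sum_(0 <= i < size s) `|g (nth b (a :: s) i.+1) - g (nth b (a :: s) i)|
  = chords g a s.
Proof.
elim: s a => [|x s IH] a /=; first by rewrite big_nil.
by rewrite big_nat_recl //= -IH.
Qed.

Lemma arclengthE a b g :
  arclength a b g = ereal_sup [set (chords g a s)%:E | s in itv_partition a b].
Proof.
rewrite /arclength; congr ereal_sup.
by apply/seteqP; split => z [s ps <-]; exists s => //; rewrite chords_sum.
Qed.

Lemma chords_cat g a s1 s2 :
  chords g a (s1 ++ s2) = chords g a s1 + chords g (last a s1) s2.
Proof. by elim: s1 a => [|x s IH] a /=; rewrite ?add0r // IH addrA. Qed.

Lemma arclength_ub a b g s :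
  itv_partition a b s -> ((chords g a s)%:E <= arclength a b g)%E.
Proof. by move=> ps; rewrite arclengthE; apply: ereal_sup_ubound; exists s. Qed.

Lemma arclength_le a b g (M : \bar R) :
  (forall s, itv_partition a b s -> ((chords g a s)%:E <= M)%E) ->
  (arclength a b g <= M)%E.
Proof. by move=> H; rewrite arclengthE; apply: ge_ereal_sup => _ [s ps <-]; exact: H. Qed.

Lemma itv_partition_exists a b : a <= b -> exists s, itv_partition a b s.
Proof.
rewrite le_eqVlt => /orP[/eqP->|ab]; last by exists [:: b]; exact: itv_partition1.
by exists [::]; split.
Qed.

Lemma chord_le_arclength a b g : a <= b -> (`|g b - g a|%:E <= arclength a b g)%E.
Proof.
rewrite le_eqVlt => /orP[/eqP->|ab].
  by rewrite subrr normr0; apply: (@arclength_ub _ _ _ [::]); split.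
have := arclength_ub g (itv_partition1 ab).
by rewrite /= addr0.
Qed.

Lemma arclength_ge0 a b g : a <= b -> (0 <= arclength a b g)%E.
Proof. by move=> ab; rewrite (le_trans _ (chord_le_arclength g ab)) // lee_fin. Qed.

(** Inserting [c] as a partition point can only increase the sum of chords, by
    the triangle inequality. *)
Lemma itv_partition_split a b c g s : a <= c -> c <= b -> itv_partition a b s ->
  exists s1 s2, [/\ itv_partition a c s1, itv_partition c b s2 &
    chords g a s <= chords g a s1 + chords g c s2].
Proof.
elim: s a => [|x s IH] a ac cb ps.
  have ab := itv_partition_nil ps.
  have ca : c = a by apply/eqP; rewrite eq_le ac ab cb.
  have nil_itv x : itv_partition x x [::] by split => /=.
  by exists [::], [::]; rewrite ca -ab /= addr0; split.
have pxs := itv_partition_cons ps.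
case: ps => /= /andP[ax pa] lb.
have [xc|cx] := leP x c.
  have [s1 [s2 [p1 p2 le12]]] := IH x xc cb pxs.
  exists (x :: s1), s2; split => //=.
    by case: p1 => q1 q2; split => //=; rewrite ax.
  by rewrite -addrA lerD2l.
move: ac; rewrite le_eqVlt => /orP[/eqP<-|ac].
  by exists [::], (x :: s); split; [split => /=|split => //=; rewrite ax|rewrite /= add0r].
exists [:: c], (x :: s); split; first exact: itv_partition1.
  by split => //=; rewrite cx.
rewrite /=.
rewrite addr0 addrA lerD2r addrC.
by have := ler_normD (g x - g c) (g c - g a); rewrite subrKA.
Qed.

Lemma arclength_subadditive a b c g : a <= c -> c <= b ->
  (arclength a b g <= arclength a c g + arclength c b g)%E.
Proof.
move=> ac cb; apply: arclength_le => s /(itv_partition_split g ac cb)[s1 [s2 [p1 p2 le12]]].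
apply: (@le_trans _ _ ((chords g a s1)%:E + (chords g c s2)%:E)%E).
  by rewrite -EFinD lee_fin.
by apply: leeD; exact: arclength_ub.
Qed.

(** Partitions of the two halves concatenate to partitions of the whole.  The
    suprema are taken one after the other, since subtracting a finite quantity is
    harmless; when the right half has infinite length so does the whole. *)
Lemma arclength_superadditive a b c g : a <= c -> c <= b ->
  (arclength a c g + arclength c b g <= arclength a b g)%E.
Proof.
move=> ac cb.
have step s1 : itv_partition a c s1 ->
    ((chords g a s1)%:E + arclength c b g <= arclength a b g)%E.
  move=> p1; rewrite addeC -leeBrDr //; apply: arclength_le => s2 p2.
  rewrite leeBrDr // -EFinD addrC.
  have <- : chords g a (s1 ++ s2) = chords g a s1 + chords g c s2.
    by rewrite chords_cat; case: p1 => _ /eqP->.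
  exact/arclength_ub/(itv_partition_cat p1 p2).
have [fin|] := boolP (arclength c b g \is a fin_num).
  rewrite -leeBrDr //; apply: arclength_le => s1 p1.
  by rewrite leeBrDr //; exact: step.
rewrite ge0_fin_numE ?arclength_ge0 // -leNgt leye_eq => /eqP ey.
have [s1 p1] := itv_partition_exists ac.
by have := step s1 p1; rewrite ey addey // leye_eq => /eqP ->; rewrite leey.
Qed.

Lemma arclength_monol a b c g : a <= c -> c <= b ->
  (arclength a c g <= arclength a b g)%E.
Proof.
move=> ac cb; rewrite (le_trans _ (arclength_superadditive g ac cb)) //.
by rewrite leeDl // arclength_ge0.
Qed.

Lemma arclength_monor a b c g : a <= c -> c <= b ->
  (arclength c b g <= arclength a b g)%E.
Proof.
move=> ac cb; rewrite (le_trans _ (arclength_superadditive g ac cb)) //.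
by rewrite leeDr // arclength_ge0.
Qed.

Lemma arclength_eq a b g h : (forall t, a <= t <= b -> g t = h t) ->
  arclength a b g = arclength a b h.
Proof.
move=> gh; rewrite !arclengthE; congr ereal_sup.
have H s : itv_partition a b s -> chords g a s = chords h a s.
  elim: s a gh => //= x s IH a gh ps.
  have pxs := itv_partition_cons ps.
  have xb := itv_partition_le pxs.
  case: ps => /= /andP[ax _] _.
  rewrite (IH x) //; last by move=> t /andP[xt tb]; rewrite gh // tb (le_trans (ltW ax)).
  rewrite (gh x) ?xb ?(ltW ax) // (gh a) // lexx /=.
  exact: le_trans (ltW ax) xb.
by apply/seteqP; split => z [s ps <-]; exists s => //; rewrite H.
Qed.

Lemma arclength_lip a b g (k : R) :
  (forall t u, a <= t -> t <= u -> u <= b -> `|g u - g t| <= k * (u - t)) ->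
  (arclength a b g <= (k * (b - a))%:E)%E.
Proof.
move=> lip; apply: arclength_le => s; rewrite lee_fin.
elim: s a lip => [|x s IH] a lip ps.
  by rewrite (itv_partition_nil ps) subrr mulr0.
have pxs := itv_partition_cons ps.
have xb := itv_partition_le pxs.
case: ps => /= /andP[/ltW ax _] _.
have -> : k * (b - a) = k * (x - a) + k * (b - x) by ring.
apply: lerD; first exact: lip.
by apply: IH => // t u xt; apply: lip; exact: le_trans xt.
Qed.

Lemma arclengthxx a g : arclength a a g = 0%E.
Proof.
apply/le_anti; rewrite arclength_ge0 // andbT.
by apply: arclength_le => s /itv_partitionxx ->.
Qed.

End ArcLength.

(** * Polygons *)
Section Polygons.
Context {R : realType} {E : completeNormedModType R}.
Implicit Types (x y z : E) (s : seq E) (t : R).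

Definition seg x y t : E := x + t *: (y - x).

Lemma seg0 x y : seg x y 0 = x.
Proof. by rewrite /seg scale0r addr0. Qed.

Lemma seg1 x y : seg x y 1 = y.
Proof. by rewrite /seg scale1r addrC subrK. Qed.

Lemma seg_dist x y t t' : `|seg x y t' - seg x y t| = `|t' - t| * `|y - x|.
Proof.
by rewrite /seg opprD addrACA subrr add0r -scalerBl normrZ.
Qed.

Lemma seg_inj x y : x != y -> injective (seg x y).
Proof.
move=> xy t t' /eqP; rewrite -subr_eq0 -normr_eq0 seg_dist mulf_eq0 !normr_eq0.
by rewrite !subr_eq0 [y == x]eq_sym (negbTE xy) orbF => /eqP.
Qed.

Lemma seg_continuous x y : continuous (seg x y).
Proof.
move=> t; apply: cvgD; first exact: cvg_cst.
by apply: cvgZ; [exact: cvg_id|exact: cvg_cst].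
Qed.

(** A polygon is given by its first vertex and the list of the following ones. *)
Fixpoint plen x s : R := if s is y :: s' then `|y - x| + plen y s' else 0.

(** [l1] and [l2] are the lengths of the polygon before and after [z].  They are
    arguments rather than functions of [z] because a polygon that crosses itself
    passes through [z] several times. *)
Fixpoint onpoly x s z (l1 l2 : R) : Prop :=
  if s is y :: s' then
    (exists t, [/\ 0 <= t <= 1, z = seg x y t, l1 = t * `|y - x| &
                   l2 = (1 - t) * `|y - x| + plen y s'])
    \/ (exists2 l, onpoly y s' z l l2 & l1 = `|y - x| + l)
  else [/\ z = x, l1 = 0 & l2 = 0].

Lemma plen_ge0 x s : 0 <= plen x s.
Proof. by elim: s x => //= y s IH x; rewrite addr_ge0. Qed.

Lemma onpoly_len x s z l1 l2 : onpoly x s z l1 l2 ->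
  [/\ 0 <= l1, 0 <= l2 & l1 + l2 = plen x s].
Proof.
elim: s x l1 => [|y s IH] x l1 /=; first by move=> [_ -> ->]; rewrite addr0.
have p0 := plen_ge0 y s; have n0 := normr_ge0 (y - x).
case=> [[t [/andP[t0 t1] _ -> ->]]|[l /IH[l0 l20 ls] ->]].
  by split; [rewrite mulr_ge0|rewrite addr_ge0 // mulr_ge0 // subr_ge0|ring].
by split => //; [rewrite addr_ge0|rewrite -addrA ls].
Qed.

Lemma onpoly_dist_start x s z l1 l2 : onpoly x s z l1 l2 -> `|z - x| <= l1.
Proof.
elim: s x l1 => [|y s IH] x l1 /=; first by move=> [-> -> _]; rewrite subrr normr0.
case=> [[t [/andP[t0 t1] -> -> _]]|[l /IH yz ->]].
  by rewrite -{2}(seg0 x y) seg_dist subr0 ger0_norm.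
rewrite -(subrK y z) -addrA addrC (le_trans (ler_normD _ _)) //.
by rewrite lerD.
Qed.

Lemma last_dist_le_plen x s : `|last x s - x| <= plen x s.
Proof.
elim: s x => [|y s IH] x /=; first by rewrite subrr normr0.
rewrite -(subrK y (last y s)) -addrA addrC (le_trans (ler_normD _ _)) //.
by rewrite lerD.
Qed.

Lemma onpoly_dist_end x s z l1 l2 : onpoly x s z l1 l2 -> `|last x s - z| <= l2.
Proof.
elim: s x l1 => [|y s IH] x l1 /=; first by move=> [-> _ ->]; rewrite subrr normr0.
case=> [[t [/andP[t0 t1] -> _ ->]]|[l /IH //]].
rewrite -(subrK y (last y s)) -addrA addrC (le_trans (ler_normD _ _)) //.
rewrite lerD ?last_dist_le_plen // -{1}(seg1 x y) seg_dist ger0_norm //.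
by rewrite subr_ge0.
Qed.

Lemma plen_cat x s1 s2 : plen x (s1 ++ s2) = plen x s1 + plen (last x s1) s2.
Proof. by elim: s1 x => [|y s IH] x /=; rewrite ?add0r // IH addrA. Qed.

Lemma onpoly_cat x s1 s2 z l1 l2 : onpoly x (s1 ++ s2) z l1 l2 ->
  (exists2 l, onpoly x s1 z l1 l & l2 = l + plen (last x s1) s2) \/
  (exists2 l, onpoly (last x s1) s2 z l l2 & l1 = plen x s1 + l).
Proof.
elim: s1 x l1 => [|y s IH] x l1 /=; first by right; exists l1 => //; rewrite add0r.
case=> [[t [t01 zt l1t l2t]]|[l /IH H ->]].
  left; exists ((1 - t) * `|y - x| + plen y s); last by rewrite l2t plen_cat addrA.
  by left; exists t.
case: H => [[l' p e]|[l' p ->]]; [left|right].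
  by exists l' => //; right; exists l.
by exists l' => //; rewrite addrA.
Qed.

(** The parameters at which [g] lies on the segment form a compact set. *)
Lemma last_hit (a b : R) (g : R -> E) x y :
  a <= b -> {within `[a, b], continuous g} -> g a = y ->
  exists (tau r : R), [/\ a <= tau <= b, 0 <= r <= 1, g tau = seg x y r &
    forall t r', tau < t <= b -> 0 <= r' <= 1 -> g t <> seg x y r'].
Proof.
move=> ab cg ga.
pose S := seg x y @` `[0, 1].
have cS : closed S.
  apply: compact_closed; first exact: norm_hausdorff.
  apply: continuous_compact; last exact: segment_compact.
  by apply: continuous_subspaceT; exact: seg_continuous.
have [V cV VE] : exists2 V, closed V & V `&` `[a, b] = g @^-1` S `&` `[a, b].
  by move/continuous_closedP : cg => /(_ S cS) /closed_subspaceP[V cV VE]; exists V.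
have cT : compact (V `&` `[a, b]).
  by rewrite setIC; apply: compact_closedI => //; exact: segment_compact.
have [||tau tauT tauM] := compact_EVT_max (f := @id R) _ cT.
- exists a; rewrite VE; split; last by rewrite /= in_itv /= lexx ab.
  by exists 1; rewrite ?seg1 //= in_itv /= ler01 lexx.
- by apply: continuous_subspaceT => ?; exact: cvg_id.
move: tauT; rewrite inE VE => -[[r /= r01 gr] tab].
exists tau, r; split.
- by move: tab; rewrite /= in_itv.
- by move: r01; rewrite /= in_itv.
- by rewrite gr.
move=> t r' /andP[taut tb] r01' gt.
move: tab; rewrite /= in_itv /= => /andP[atau _].
have : t \in V `&` `[a, b].
  rewrite inE VE; split; last by rewrite /= in_itv /= tb (le_trans atau (ltW taut)).
  by exists r' => //=; rewrite in_itv.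
by move/tauM; rewrite leNgt taut.
Qed.

End Polygons.

(** * Loop erasure *)
Section LoopErasure.
Context {R : realType} {E : completeNormedModType R}.
Implicit Types (x y z : E) (s : seq E) (a b t : R) (g h : R -> E).

Definition arc_in_polygon x s a b g : Prop :=
  [/\ a <= b,
      {within `[a, b], continuous g},
      {in `[a, b] &, injective g},
      g a = x /\ g b = last x s &
      forall t, t \in `[a, b] -> exists l1 l2,
        [/\ onpoly x s (g t) l1 l2, (arclength a t g <= l1%:E)%E &
            (arclength t b g <= l2%:E)%E]].

(** The case of [arc_prepend] in which the whole new segment is erased. *)
Lemma arc_restrict x s a b g tau : arc_in_polygon x s a b g -> a <= tau <= b ->
  forall y, g tau = y -> arc_in_polygon y (x :: s) tau b g.
Proof.
move=> [ab cg ig [ga gb] H] /andP[atau taub] y gy.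
have sub : `[tau, b] `<=` `[a, b].
  by move=> t /=; rewrite !in_itv /= => /andP[h1 ->]; rewrite (le_trans atau).
split => //.
- exact: continuous_subspaceW cg.
- by move=> t u /sub tab /sub uab; exact: ig.
- move=> t tI; have /= := sub t tI => tab; have [l1 [l2 [q1 q2 q3]]] := H _ tab.
  exists (`|x - y| + l1), l2; split => //; first by right; exists l1.
  move: tI; rewrite in_itv /= => /andP[taut _].
  apply: (le_trans (arclength_monor g atau taut)); apply: (le_trans q2).
  by rewrite lee_fin lerDr.
Qed.

(** The new arc follows the segment from [x] to the last point [g tau] of the old
    arc on it, and then the old arc.  It is injective because the old arc does not
    meet the segment after [tau], and both pieces are no longer than the parts
    of the polygon that they replace. *)
Lemma arc_prepend x y s a b g : arc_in_polygon y s a b g ->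
  exists a' b' h, arc_in_polygon x (y :: s) a' b' h.
Proof.
move=> A; have [ab cg ig [ga gb] H] := A.
have [tau [r [/andP[atau taub] /andP[r0 r1] gtau last_t]]] := last_hit x ab cg ga.
have [gx|gnx] := eqVneq (g tau) x.
  by exists tau, b, g; apply: (arc_restrict A) => //; rewrite atau taub.
have xy : x != y.
  by apply: contra_neq gnx => xy; rewrite gtau xy /seg subrr scaler0 addr0.
have rN0 : r != 0 by apply: contra_neq gnx => r_0; rewrite gtau r_0 seg0.
have rp : 0 < r by rewrite lt_neqAle eq_sym rN0.
(* the segment part is parametrized by the unit interval ending at tau *)
pose p t := r * (t - tau + 1).
pose h t := if t <= tau then seg x y (p t) else g t.
have hle t : t <= tau -> h t = seg x y (p t) by rewrite /h => ->.
have hge t : tau <= t -> h t = g t.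
  rewrite /h le_eqVlt => /orP[/eqP <-|]; last by rewrite ltNge => /negbTE ->.
  by rewrite lexx /p subrr add0r mulr1 -gtau.
have p01 t : tau - 1 <= t -> t <= tau -> 0 <= p t <= 1.
  move=> t1 t2; rewrite /p mulr_ge0 //=; last by lra.
  by rewrite mulr_ile1 //; lra.
have lip t u : tau - 1 <= t -> t <= u -> u <= tau ->
    (arclength t u h <= (r * `|y - x| * (u - t))%:E)%E.
  move=> t1 tu ut; apply: arclength_lip => v w tv vw wu.
  rewrite !hle ?(le_trans wu) // ?(le_trans vw) ?(le_trans wu) //.
  rewrite seg_dist /p -mulrBr normrM (ger0_norm r0).
  rewrite (_ : w - tau + 1 - (v - tau + 1) = w - v); last by ring.
  by rewrite ger0_norm ?subr_ge0 // -!mulrA [X in _ * X]mulrC.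
have [m1 [m2 [/onpoly_len[m10 m20 msum] lenab _]]] : exists l1 l2,
  [/\ onpoly y s (g b) l1 l2, (arclength a b g <= l1%:E)%E &
            (arclength b b g <= l2%:E)%E].
  by apply: H; rewrite in_itv /= ab lexx.
have {m1 m2 m10 m20 msum} lenab : (arclength a b g <= (plen y s)%:E)%E.
  by rewrite (le_trans lenab) // lee_fin -msum lerDl.
have lenN t u : tau <= t -> arclength t u h = arclength t u g.
  by move=> tt; apply: arclength_eq => v /andP[tv _]; rewrite hge // (le_trans tt).
exists (tau - 1), b, h; split.
- by lra.
- have -> : [set` `[tau - 1, b]] = [set` `[tau - 1, tau]] `|` [set` `[tau, b]].
    apply/seteqP; split => t /=; rewrite !in_itv /=.
      move=> /andP[-> ->]; have [tt|/ltW tt] := leP t tau; first by left.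
      by right; rewrite tt.
    by case=> /andP[t1 t2]; apply/andP; split; lra.
  apply: withinU_continuous; try exact: interval_closed.
    have cp : {within `[tau - 1, tau], continuous (fun t => seg x y (p t))}.
      apply: continuous_subspaceT => t; apply: (@continuous_comp _ _ _ p (seg x y)).
        apply: cvgM; first exact: cvg_cst.
        by apply: cvgD; [apply: cvgB; [exact: cvg_id|exact: cvg_cst]|exact: cvg_cst].
      exact: seg_continuous.
    apply: subspace_eq_continuous cp => t; rewrite inE /= in_itv /= => /andP[_ tt].
    exact/esym/hle.
  have cg' : {within `[tau, b], continuous g}.
    apply: continuous_subspaceW cg => t /=; rewrite !in_itv /= => /andP[h1 ->].
    by rewrite (le_trans atau).
  apply: subspace_eq_continuous cg' => t; rewrite inE /= in_itv /= => /andP[tt _].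
  exact/esym/hge.
- have mixed t u : tau - 1 <= t -> t <= tau -> tau < u -> u <= b -> h t <> h u.
    move=> t1 t2 u1 u2; rewrite hle // hge ?ltW // => /esym.
    by apply: last_t; [rewrite u1|exact: p01].
  move=> t u; rewrite !in_itv /= => /andP[t1 t2] /andP[u1 u2].
  have [tt|tt] := leP t tau; have [ut|ut] := leP u tau.
  + rewrite !hle // => /(seg_inj xy) /(mulfI rN0); lra.
  + by move=> e; case: (mixed _ _ t1 tt ut u2).
  + by move=> e; case: (mixed _ _ u1 ut tt t2).
  + by rewrite !hge ?ltW // => /ig; apply; rewrite in_itv /= ?t2 ?u2 andbT; lra.
- split; last by rewrite hge.
  by rewrite hle ?lerBlDr ?lerDl // (_ : p _ = 0) ?seg0 // /p; ring.
- move=> t; rewrite in_itv /= => /andP[t1 t2].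
  have n0 := normr_ge0 (y - x).
  have [tt|/ltW tt] := leP t tau.
    exists (p t * `|y - x|), ((1 - p t) * `|y - x| + plen y s); split.
    + by left; exists (p t); split => //; [exact: p01|rewrite hle].
    + apply: le_trans (lip _ _ (lexx _) t1 tt) _; rewrite lee_fin /p.
      by rewrite le_eqVlt; apply/orP; left; apply/eqP; ring.
    + apply: le_trans (arclength_subadditive h tt taub) _; rewrite EFinD.
      apply: leeD; last first.
        by rewrite lenN // (le_trans (arclength_monor g atau taub)).
      apply: le_trans (lip _ _ t1 tt (lexx _)) _; rewrite lee_fin /p.
      rewrite -subr_ge0 (_ : _ - _ = (1 - r) * `|y - x|); last by ring.
      by rewrite mulr_ge0 // subr_ge0.
  have tab : t \in `[a, b] by rewrite in_itv /= t2 (le_trans atau).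
  have [l1 [l2 [q1 q2 q3]]] := H t tab.
  exists (`|y - x| + l1), l2; split.
  + by right; exists l1 => //; rewrite hge.
  + apply: le_trans (arclength_subadditive h _ tt) _; first by lra.
    rewrite EFinD; apply: leeD.
      apply: le_trans (lip _ _ (lexx _) _ (lexx _)) _; first by lra.
      by rewrite lee_fin (_ : tau - _ = 1) ?mulr1 ?ler_piMl //; ring.
    by rewrite lenN // (le_trans (arclength_monor g atau tt)).
  + by rewrite lenN.
Qed.

Lemma loop_erasure x s : exists a b g, arc_in_polygon x s a b g.
Proof.
elim: s x => [|y s IH] x; last by have [a [b [g /arc_prepend]]] := IH y; exact.
exists 0, 0, (fun=> x).
have I00 t : t \in `[0, 0 : R] -> t = 0.
  by rewrite in_itv /= => /le_anti.
split => //.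
- by apply: continuous_subspaceT => ?; exact: cvg_cst.
- by move=> t u /I00 -> /I00 ->.
- by move=> t /I00 ->; exists 0, 0; rewrite arclengthxx; split.
Qed.

Lemma polygon_arc x s (U : set E) :
  (forall z l1 l2, onpoly x s z l1 l2 -> U z) ->
  exists a b g, [/\ rectifiable_arc U x (last x s) a b g,
    (arclength a b g <= (plen x s)%:E)%E &
    forall t, t \in `[a, b] -> exists l1 l2,
        [/\ onpoly x s (g t) l1 l2, (arclength a t g <= l1%:E)%E &
            (arclength t b g <= l2%:E)%E]].
Proof.
move=> HU; have [a [b [g [ab cg ig [ga gb] H]]]] := loop_erasure x s.
have len : (arclength a b g <= (plen x s)%:E)%E.
  have [|l1 [l2 [/onpoly_len[l10 l20 <-] q _]]] := H b.
    by rewrite in_itv /= ab lexx.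
  by rewrite (le_trans q) // lee_fin lerDl.
exists a, b, g; split => //; split => //.
- by move=> _ [t /= tab <-]; have [l1 [l2 [/HU]]] := H t tab.
- by split => //; rewrite (le_lt_trans len) // ltry.
Qed.

End LoopErasure.

(** * Distance to the boundary *)
Section BoundaryDistance.
Context {R : realType} {E : completeNormedModType R}.
Implicit Types (U : set E) (x y z w : E) (r : R).

Lemma open_normP U z : open U -> U z ->
  exists2 r, 0 < r & forall w, `|z - w| < r -> U w.
Proof.
move=> oU Uz; have /nbhs_ballP[r /= r0 rU] : nbhs z U by exact: open_nbhs_nbhs.
by exists r => // w zw; apply: rU; rewrite -ball_normE.
Qed.

Lemma closure_normP U z : closure U z <->
  forall r, 0 < r -> exists2 w, U w & `|z - w| < r.
Proof.
split=> [cz r r0|H B /nbhs_ballP[r /= r0 rB]].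
  have [w [Uw]] := cz _ (nbhsx_ballx z r r0).
  by rewrite -ball_normE => zw; exists w.
have [w Uw zw] := H r r0; exists w; split => //.
by apply: rB; rewrite -ball_normE.
Qed.

(** The first point of the segment outside [U] is a boundary point. *)
Lemma boundary_on_segment U z w : open U -> U z -> ~ U w ->
  exists2 q, boundary U q & `|z - q| <= `|z - w|.
Proof.
move=> oU Uz nUw.
pose T := (seg z w) @^-1` (~` U) `&` `[0, 1].
have cT : compact T.
  rewrite /T setIC; apply: compact_closedI; first exact: segment_compact.
  apply: closed_comp; first by move=> t _; exact: seg_continuous.
  exact: open_closedC.
have [||m] := compact_EVT_min (f := @id R) _ cT.
- by exists 1; split; rewrite /= ?seg1 // in_itv /= ler01 lexx.
- by apply: continuous_subspaceT => ?; exact: cvg_id.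
rewrite inE => -[/= nUm]; rewrite in_itv /= => /andP[m0 m1] minm.
exists (seg z w m); last first.
  rewrite distrC -{2}(seg0 z w) seg_dist subr0 ger0_norm // distrC.
  by rewrite ler_piMl.
split; last by move/interior_subset.
have {}m0 : 0 < m.
  rewrite lt_neqAle m0 andbT eq_sym; apply/eqP => m_0; apply: nUm.
  by rewrite m_0 seg0.
apply/closure_normP => r r0.
have [e /= e0 He] : exists2 e, 0 < e &
    forall t, `|m - t| < e -> `|seg z w m - seg z w t| < r.
  have /cvgrPdist_lt/(_ _ r0)/nbhs_ballP[e e0 He] := @seg_continuous _ _ z w m.
  by exists e => // t mt; apply: He.
pose t := Num.max 0 (m - e / 2).
have t0 : 0 <= t by rewrite /t le_max lexx.
have tm : t < m by rewrite /t gt_max m0 ltrBlDr ltrDl divr_gt0.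
exists (seg z w t); last first.
  apply: He; rewrite ger0_norm ?subr_ge0 ?ltW //.
  have : m - e / 2 <= t by rewrite /t le_max lexx orbT.
  by lra.
apply: contrapT => nUt.
have : m <= t.
  by apply: minm; rewrite inE; split => //=; rewrite in_itv /= t0 (le_trans (ltW tm)).
by rewrite leNgt tm.
Qed.

(** The distance to the boundary of an open set is the distance to its
    complement: the boundary lies in the complement, and every segment from [z] to
    the complement crosses the boundary.  All later estimates go through this
    characterization. *)
Lemma bdistP U z r : open U -> U != [set: E] -> U z ->
  r <= bdist U z <-> forall w, ~ U w -> r <= `|z - w|.
Proof.
move=> oU /eqP UT Uz.
have lbU : has_lbound [set `|z - w| | w in boundary U].
  by exists 0 => _ [w _ <-].
split=> [rU w nUw|H].
  have [q bq zq] := boundary_on_segment oU Uz nUw.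
  apply: le_trans rU _; apply: le_trans zq.
  by apply: ge_inf => //; exists q.
have [w nUw] : exists w, ~ U w.
  apply: contrapT => nw; apply: UT; apply/seteqP; split => // w _.
  by apply: contrapT => nUw; apply: nw; exists w.
have [q bq _] := boundary_on_segment oU Uz nUw.
apply: lb_le_inf; first by exists `|z - q|, q.
move=> _ [v [_ nv] <-]; apply: H; apply: contra_not nv.
by rewrite (interior_id _).1.
Qed.

Lemma bdist_gt0 U z : open U -> U != [set: E] -> U z -> 0 < bdist U z.
Proof.
move=> oU UT Uz; have [r r0 H] := open_normP oU Uz.
apply: (lt_le_trans r0); apply/bdistP => // w; rewrite leNgt.
by move=> nUw; apply/negP => /H.
Qed.

Lemma bdist_le U z w : open U -> U != [set: E] -> U z -> ~ U w ->
  bdist U z <= `|z - w|.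
Proof.
move=> oU UT Uz nUw; have [/(_ (lexx _)) H _] := bdistP (bdist U z) oU UT Uz.
exact: H.
Qed.

Lemma lt_bdist U z w : open U -> U != [set: E] -> U z -> `|z - w| < bdist U z -> U w.
Proof.
move=> oU UT Uz; rewrite ltNge => /negP H; apply: contrapT => nU; apply: H.
exact: bdist_le.
Qed.

Lemma bdist_lip U z w : open U -> U != [set: E] -> U z -> U w ->
  bdist U z <= bdist U w + `|z - w|.
Proof.
move=> oU UT Uz Uw; rewrite -lerBlDr; apply/bdistP => // v nUv.
rewrite lerBlDr (le_trans (bdist_le oU UT Uz nUv)) // [leRHS]addrC.
exact: ler_distD.
Qed.

Lemma bdist_near U z w r : open U -> U != [set: E] -> U z -> `|z - w| <= r ->
  r < bdist U z -> U w /\ bdist U z - r <= bdist U w.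
Proof.
move=> oU UT Uz zw rU; have Uw : U w by apply: lt_bdist (le_lt_trans zw rU).
by split=> //; have := bdist_lip oU UT Uz Uw; lra.
Qed.

Lemma bdist_sub U V z : open U -> U != [set: E] -> open V -> V != [set: E] ->
  U `<=` V -> U z -> bdist U z <= bdist V z.
Proof.
move=> oU UT oV VT UV Uz; apply/bdistP => //; first exact: UV.
by move=> w nVw; apply: bdist_le => // /UV.
Qed.

End BoundaryDistance.

(** * Joining points in a punctured space *)
Section PuncturedSpace.
Context {R : realType} {E : completeNormedModType R}.
Implicit Types (u v w x y z p e : E) (s : seq E) (r t : R).

Lemma not_on_line e : dim_ge2 E -> exists x, forall t, x <> t *: e.
Proof.
move=> [u [v indep]]; apply: contrapT => all.
have onl x : exists t, x = t *: e.
  by apply: contrapT => nx; apply: all; exists x => t xt; apply: nx; exists t.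
have [r ru] := onl u; have [r' rv] := onl v.
have [|_ /eqP] := indep r' (- r).
  by rewrite ru rv !scalerA -scalerDl (_ : _ + _ = 0) ?scale0r //; ring.
rewrite oppr_eq0 => /eqP r_0.
have [|/eqP] := indep 1 0; last by rewrite oner_eq0.
by rewrite ru r_0 !scale0r scaler0 addr0.
Qed.

Lemma norm_surjective r : dim_ge2 E -> 0 <= r -> exists e : E, `|e| = r.
Proof.
move=> dimE r0; have [y y0] := not_on_line (0 : E) dimE.
have yn : 0 < `|y|.
  by rewrite normr_gt0; apply/eqP => y_0; apply: (y0 0); rewrite y_0 scaler0.
exists ((r / `|y|) *: y).
by rewrite normrZ normrM normfV normr_id (ger0_norm r0) divfK // gt_eqF.
Qed.

(** Normalize [x - t0 *: e], where [t0 *: e] is a point of the line nearest to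
    some [x] outside it; the nearest point exists because the distance from [x]
    tends to infinity along the line. *)
Lemma birkhoff_orthogonal e : dim_ge2 E -> e != 0 ->
  exists2 w, `|w| = 1 & forall t, 1 <= `|w - t *: e|.
Proof.
move=> dimE e0; have [x xe] := not_on_line e dimE.
have en : 0 < `|e| by rewrite normr_gt0.
pose f t := `|x - t *: e|.
pose M := 2 * `|x| / `|e|.
have M0 : 0 <= M by rewrite divr_ge0 // mulr_ge0.
have cf : {within `[- M, M], continuous f}.
  apply: continuous_subspaceT => t; apply: cvg_norm.
  apply: cvgB; first exact: cvg_cst.
  by apply: cvgZ; [exact: cvg_id|exact: cvg_cst].
have [|t0 _ t0min] := EVT_min _ cf; first by lra.
have {}t0min t : f t0 <= f t.
  have [tM|] := boolP (t \in `[- M, M]); first exact: t0min.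
  rewrite in_itv /= -ler_norml -ltNge => Mt.
  apply: (@le_trans _ _ (f 0)); first by apply: t0min; rewrite in_itv /=; lra.
  rewrite /f scale0r subr0.
  have : `|t *: e| <= `|x| + `|x - t *: e|.
    by have := ler_normB x (x - t *: e); rewrite opprB addrC subrK.
  rewrite normrZ; move: Mt; rewrite /M ltr_pdivrMr //; lra.
have y0 : 0 < f t0.
  by rewrite normr_gt0 subr_eq0; apply/eqP; exact: xe.
exists ((f t0)^-1 *: (x - t0 *: e)).
  by rewrite normrZ gtr0_norm ?invr_gt0 // mulVf // gt_eqF.
move=> t; have -> : (f t0)^-1 *: (x - t0 *: e) - t *: e =
    (f t0)^-1 *: (x - (t0 + f t0 * t) *: e).
  rewrite scalerDl -(scalerA _ t) opprD addrA [RHS]scalerBr [X in _ = _ - X]scalerA.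
  by rewrite mulVf ?gt_eqF // scale1r.
by rewrite normrZ gtr0_norm ?invr_gt0 // mulrC ler_pdivlMr // mul1r t0min.
Qed.

(** With [w1] orthogonal to [u] and [e] the direction of [u], both [w1] and
    [w1 + e] are at distance at least 1 from the line of [u].  The line of [v]
    cannot be close to both: it would then be close to [w1] and to their
    difference [e], hence [e] would be close to the line of [w1], which the choice
    of [w1] excludes. *)
Lemma transversal u v : dim_ge2 E -> u != 0 -> exists2 w, `|w| <= 2 &
  forall t, 16^-1 <= `|w - t *: u| /\ 16^-1 <= `|w - t *: v|.
Proof.
move=> dimE u0; have [w1 w1n w1u] := birkhoff_orthogonal dimE u0.
have un : 0 < `|u| by rewrite normr_gt0.
have [H|] := pselect (forall t, 16^-1 <= `|w1 - t *: v|).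
  by exists w1; [lra|move=> t; split => //; have := w1u t; lra].
move=> /existsNP[a /negP]; rewrite -ltNge => wav.
pose e := `|u|^-1 *: u.
have en : `|e| = 1 by rewrite normrZ gtr0_norm ?invr_gt0 // mulVf // gt_eqF.
exists (w1 + e); first by rewrite (le_trans (ler_normD _ _)) // w1n en; lra.
move=> t; split.
  have := w1u (t - `|u|^-1); rewrite scalerBl opprB addrA -/e.
  lra.
rewrite leNgt; apply/negP => wbv.
have av : 15/16 < `|a *: v|.
  by have := ler_normD (w1 - a *: v) (a *: v); rewrite subrK w1n; lra.
have a0 : a != 0 by apply/eqP => a0; move: av; rewrite a0 scale0r normr0; lra.
pose k := (t - a) / a.
have kav : k *: (a *: v) = (t - a) *: v by rewrite scalerA /k divfK.
have ekav : `|e - k *: (a *: v)| < 8^-1.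
  rewrite kav.
  have -> : e - (t - a) *: v = (w1 + e - t *: v) - (w1 - a *: v).
    rewrite scalerBl !opprB [RHS]addrA [RHS]addrC !addrA addNr add0r.
    exact: addrAC.
  by rewrite (le_lt_trans (ler_normB _ _)) //; lra.
have kbnd : `|k| < 6/5.
  have h1 : `|k| * `|a *: v| < 9/8.
    rewrite -normrZ; have := ler_normB e (e - k *: (a *: v)).
    by rewrite opprB addrC subrK en; lra.
  have := normr_ge0 k; nra.
have : `|e - k *: w1| < 2^-1.
  have -> : e - k *: w1 = (e - k *: (a *: v)) - k *: (w1 - a *: v).
    by rewrite [k *: (w1 - _)]scalerBr opprB addrA subrK.
  rewrite (le_lt_trans (ler_normB _ _)) // normrZ.
  have := normr_ge0 k; nra.
apply/negP; rewrite -leNgt.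
have [kh|kh] := leP `|k| 2^-1.
  have := ler_normD (e - k *: w1) (k *: w1); rewrite subrK en normrZ w1n mulr1.
  lra.
have k0 : k != 0 by apply/eqP => k0; move: kh; rewrite k0 normr0; lra.
have -> : e - k *: w1 = - k *: (w1 - (k^-1 * `|u|^-1) *: u).
  rewrite scalerBr scalerA mulrA mulNr divff // mulN1r scaleNr.
  by rewrite scaleNr opprK addrC.
rewrite normrZ normrN; have := w1u (k^-1 / `|u|); nra.
Qed.

(** If [u] and [v] are close together compared with their distances to [p], the
    segment works.  Otherwise the polygon goes through [q = p + M *: w], where [M]
    is the larger of the two distances and [w] is transversal to both directions:
    along each of the two segments the distance to [p] grows at least linearly
    with the distance from the endpoint [u] or [v]. *)
Lemma punctured_space_uniform p u v : dim_ge2 E -> u != p -> v != p ->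
  exists s, [/\ last u s = v, plen u s <= 48 * `|u - v| &
    forall z l1 l2, onpoly u s z l1 l2 -> Num.min l1 l2 <= 48 * `|z - p|].
Proof.
move=> dimE up vp.
pose M := Num.max `|u - p| `|v - p|.
have uM : `|u - p| <= M by rewrite /M le_max lexx.
have vM : `|v - p| <= M by rewrite /M le_max lexx orbT.
have Mle r : M <= r = (`|u - p| <= r) && (`|v - p| <= r) by rewrite /M ge_max.
have up0 : u - p != 0 by rewrite subr_eq0.
have M0 : 0 < M by rewrite (lt_le_trans _ uM) // normr_gt0.
have [uv|uv] := leP `|u - v| (M / 8).
  exists [:: v]; split => //.
    by rewrite /= addr0 distrC; have := normr_ge0 (u - v); lra.
  move=> z l1 l2 zuv; have [l10 l20 l12] := onpoly_len zuv.
  have := onpoly_dist_start zuv; have := onpoly_dist_end zuv.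
  move: l12; rewrite /= addr0 ge_min distrC => l12 vz zu.
  have : M <= `|z - p| + M / 8.
    have h1 := ler_distD z u p; have h2 := ler_distD z v p.
    by rewrite Mle; move: h1; rewrite distrC (distrC u z) => h1; apply/andP; split; lra.
  by move=> h; apply/orP; left; lra.
have [w wn wt] := transversal (v - p) dimE up0.
pose q := p + M *: w.
have far (r : R) y : (forall t, 16^-1 <= `|w - t *: y|) -> 0 <= r ->
    r * M <= 16 * `|(r * M) *: w + (1 - r) *: y|.
  move=> H; rewrite le_eqVlt => /orP[/eqP<-|r0]; first by rewrite mul0r mulr_ge0.
  have rM : 0 < r * M by rewrite mulr_gt0.
  have -> : (r * M) *: w + (1 - r) *: y = (r * M) *: (w - (- ((1 - r) / (r * M))) *: y).
    by rewrite scaleNr opprK scalerDr scalerA mulrCA divff ?mulr1 // gt_eqF.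
  by rewrite normrZ gtr0_norm //; have := H (- ((1 - r) / (r * M))); nra.
have qE y : q - y = M *: w - (y - p) by rewrite /q opprB addrA [_ + p]addrC.
have qy y : `|y - p| <= M -> `|q - y| <= 3 * M.
  move=> yM; rewrite qE (le_trans (ler_normB _ _)) // normrZ gtr0_norm //; nra.
have qu := qy u uM; have vq : `|v - q| <= 3 * M by rewrite distrC qy.
exists [:: q; v]; split => //=; first by rewrite addr0; lra.
move=> z l1 l2; case=> [[t [/andP[t0 t1] -> -> _]]|[l H _]].
  rewrite ge_min; apply/orP; left.
  have -> : seg u q t - p = (t * M) *: w + (1 - t) *: (u - p).
    by rewrite /seg addrAC qE scalerBr -scalerA scalerBl scale1r addrCA.
  have := far t (u - p) (fun r => (wt r).1) t0; nra.
rewrite ge_min; apply/orP; right.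
case: H => [[t [/andP[t0 t1] -> _ ->]]|[l' [-> _ ->] _]]; last by rewrite mulr_ge0.
have -> : seg q v t - p = ((1 - t) * M) *: w + (1 - (1 - t)) *: (v - p).
  have qp : q - p = M *: w by rewrite /q addrC addKr.
  rewrite /seg addrAC qp -[v - q]opprB qE opprB scalerBr [1 - (1 - t)]subKr.
  by rewrite mulrBl mul1r scalerBl -scalerA addrCA addrC.
rewrite addr0; have := far (1 - t) (v - p) (fun r => (wt r).2); nra.
Qed.

End PuncturedSpace.

(** * Removing a sparse set *)
(** The separation [sp_sep] is the norm form of a lower bound for the
    quasihyperbolic distance, with the constant of [qh_dist_segment]. *)
Record sparse_in {R : realType} {E : completeNormedModType R} (D Q : set E) : Prop :=
  SparseIn {
    sp_dim : dim_ge2 E;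
    sp_open : open D;
    sp_neqT : D != [set: E];
    sp_sub : Q `<=` D;
    sp_closed : relatively_closed D Q;
    sp_sep : forall p q, Q p -> Q q -> p <> q -> bdist D p <= 4 * `|p - q| }.

Arguments sp_sep {R E D Q} _ [p q].

Section SparseRemoval.
Context {R : realType} {E : completeNormedModType R} {D Q : set E}.
Context (H : sparse_in D Q).
Implicit Types (u v w x y z p q : E) (s : seq E) (r t : R).

Local Notation G := (D `\` Q).
Local Notation d := (bdist D).

Lemma open_removal : open G.
Proof.
have [F cF QE] := sp_closed H.
have -> : G = D `&` ~` F.
  apply/seteqP; split => z [Dz nz]; split => //.
    by move=> Fz; apply: nz; rewrite QE.
  by rewrite QE => -[].
by apply: openI; [exact: sp_open H|exact: closed_openC].
Qed.

Lemma removal_neqT : G != [set: E].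
Proof.
apply: contra_neq (sp_neqT H) => GT; apply/seteqP; split => // z _.
by have : [set: E] z by []; rewrite -GT => -[].
Qed.

Lemma removal_bdist_ge z r : G z -> r <= d z -> (forall q, Q q -> r <= `|z - q|) ->
  r <= bdist G z.
Proof.
move=> Gz rd rQ; apply/bdistP => //; [exact: open_removal|exact: removal_neqT|].
move=> w nGw; have [Dw|nDw] := pselect (D w).
  by apply: rQ; apply: contrapT => nQ; apply: nGw.
by rewrite (le_trans rd) // (bdist_le (sp_open H) (sp_neqT H)) //; exact: Gz.1.
Qed.

(** The points of [Q] near [x] have boundary distance close to [d x], so any two of
    them are more than [d x / 5] apart. *)
Lemma removal_locally_one x p q : D x -> Q p -> Q q ->
  `|x - p| <= d x / 10 -> `|x - q| <= d x / 10 -> p = q.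
Proof.
move=> Dx Qp Qq xp xq; apply: contrapT => pq.
have h1 := sp_sep H Qp Qq pq.
have h2 := bdist_lip (sp_open H) (sp_neqT H) Dx (sp_sub H Qp).
have h3 := ler_distD x p q.
have h4 := bdist_gt0 (sp_open H) (sp_neqT H) Dx.
by move: h3; rewrite [`|p - x|]distrC => h3; lra.
Qed.

(** The polygon stays within [d x / 10] of [x], where there is at most one point
    [p] of [Q].  The constants are such that its length is at most [d x / 20];
    hence only [p] can violate the cone condition, and [punctured_space_uniform]
    deals with it. *)
Lemma local_link x u v : D x -> G u -> G v ->
  `|x - u| <= d x / 2000 -> `|x - v| <= d x / 2000 ->
  exists s, [/\ last u s = v, plen u s <= 48 * `|u - v| &
    forall z l1 l2, onpoly u s z l1 l2 ->
      G z /\ Num.min l1 l2 <= 48 * bdist G z].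
Proof.
move=> Dx Gu Gv xu xv.
have dx := bdist_gt0 (sp_open H) (sp_neqT H) Dx.
have xu40 : `|x - u| <= d x / 40 by clear -H xu dx; lra.
have uv : 48 * `|u - v| <= d x / 20.
  have := ler_distD x u v; rewrite [`|u - x|]distrC; clear -H xu xv dx; lra.
have near s z l1 l2 : onpoly u s z l1 l2 -> plen u s <= 48 * `|u - v| ->
    [/\ `|x - z| <= 3 * (d x / 40), D z, d x / 20 <= d z & Num.min l1 l2 <= d x / 20].
  move=> zs len; have [l10 l20 l12] := onpoly_len zs.
  have uz := onpoly_dist_start zs.
  have xz : `|x - z| <= 3 * (d x / 40).
    have := ler_distD u x z; rewrite [`|u - z|]distrC.
    by clear -H xu40 uz l20 l12 len uv dx; lra.
  have [|Dz dz] := bdist_near (sp_open H) (sp_neqT H) Dx xz; first by clear -H dx; lra.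
  split => //; first by clear -H dz dx; lra.
  by rewrite ge_min; apply/orP; left; clear -H l20 l12 len uv; lra.
clear xu xv.
have outside q z : d x / 10 < `|x - q| -> `|x - z| <= 3 * (d x / 40) ->
    d x / 40 <= `|z - q|.
  by have := ler_distD z x q; clear -H; lra.
have cone48 z (m : R) : D z -> m <= d x / 20 -> d x / 20 <= d z -> G z ->
    (forall q, Q q -> m <= 48 * `|z - q|) -> m <= 48 * bdist G z.
  move=> Dz md dz Gz mq; rewrite mulrC -ler_pdivrMr //.
  apply: removal_bdist_ge => // [|q /mq]; first by clear -H md dz dx; lra.
  by clear -H; lra.
have [[p [Qp xp]]|nop] := pselect (exists p, Q p /\ `|x - p| <= d x / 10).
  have up : u != p by apply/eqP => up; case: Gu => _; rewrite up.
  have vp : v != p by apply/eqP => vp; case: Gv => _; rewrite vp.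
  have [s [lasts len cone]] := punctured_space_uniform (sp_dim H) up vp.
  exists s; split => // z l1 l2 zs.
  have [xz Dz dz ml] := near s z l1 l2 zs len.
  have zp := cone z l1 l2 zs.
  have Gz : G z.
    split => // Qz.
    have zpE : z = p.
      by apply: (removal_locally_one Dx) => //; clear -H xz dx; lra.
    move: zp; rewrite zpE subrr normr0 mulr0 ge_min => /orP[l1_0|l2_0].
      have := le_trans (onpoly_dist_start zs) l1_0.
      by rewrite zpE normr_le0 subr_eq0 eq_sym (negbTE up).
    have := le_trans (onpoly_dist_end zs) l2_0.
    by rewrite zpE lasts normr_le0 subr_eq0 (negbTE vp).
  split => //; apply: cone48 => // q Qq.
  have [xq|xq] := leP `|x - q| (d x / 10).
    by rewrite -(removal_locally_one Dx Qp Qq xp xq).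
  by have := outside q z xq xz; clear -H ml dx; lra.
have uv_len : plen u [:: v] <= 48 * `|u - v|.
  by rewrite /= addr0 distrC; have := normr_ge0 (u - v); clear -H; lra.
exists [:: v]; split => // z l1 l2 zs.
have [xz Dz dz ml] := near [:: v] z l1 l2 zs uv_len.
have far q : Q q -> d x / 40 <= `|z - q|.
  move=> Qq; apply: outside xz; rewrite ltNge; apply/negP => xq.
  by case: nop; exists q.
have Gz : G z.
  by split => // /far; rewrite subrr normr0; clear -H dx; lra.
split => //; apply: cone48 => // q /far; clear -H ml dx; lra.
Qed.

(** Replacements for the points [x] of a curve, which may be close to [Q] or on it:
    between such replacements the distance to the boundary of [G] stays
    comparable with [d x]. *)
Definition well_placed x u := [/\ `|x - u| <= d x / 4000, G u & d x / 4000 <= bdist G u].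

(** Of the two points [x + e] and [x - e], at distance [2 * `|e|] from each other,
    one is at distance at least [`|e|] from the only nearby point of [Q]. *)
Lemma well_placed_exists x : D x -> exists u, well_placed x u.
Proof.
move=> Dx; have dx := bdist_gt0 (sp_open H) (sp_neqT H) Dx.
have r0 : 0 < d x / 4000 by lra.
have rd : 100 * (d x / 4000) <= d x by lra.
rewrite /well_placed; move: (d x / 4000) r0 rd => r r0 rd.
have [e en] := norm_surjective (sp_dim H) (ltW r0).
have near_removed u : `|x - u| <= r ->
    ~ [/\ `|x - u| <= r, G u & r <= bdist G u] -> exists2 q, Q q & `|u - q| < r.
  move=> xu ngood; have [Du du] := bdist_near (sp_open H) (sp_neqT H) Dx xu ltac:(lra).
  apply: contrapT => noq; apply: ngood.
  have far q : Q q -> r <= `|u - q|.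
    by move=> Qq; rewrite leNgt; apply/negP => h; apply: noq; exists q.
  have Gu : G u by split => // /far; rewrite subrr normr0 leNgt r0.
  by split => //; apply: removal_bdist_ge => //; clear -H du rd r0; lra.
have xu1 : `|x - (x + e)| <= r by rewrite opprD addrA subrr add0r normrN en.
have xu2 : `|x - (x - e)| <= r by rewrite opprB addrC subrK en.
apply: contrapT => nogood.
have [|q1 Qq1 h1] := near_removed _ xu1; first by move=> g; apply: nogood; exists (x + e).
have [|q2 Qq2 h2] := near_removed _ xu2; first by move=> g; apply: nogood; exists (x - e).
have q12 : q1 = q2.
  apply: (removal_locally_one Dx) => //.
    by have := ler_distD (x + e) x q1; clear -H xu1 h1 rd r0; lra.
  by have := ler_distD (x - e) x q2; clear -H xu2 h2 rd r0; lra.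
have diam : `|(x + e) - (x - e)| = 2 * r.
  by rewrite opprB [x + e]addrC addrACA subrr addr0 -mulr2n normrMn en mulr_natl.
have := ler_distD q1 (x + e) (x - e); rewrite diam {2}q12 [`|q2 - _|]distrC.
by clear -H h1 h2; lra.
Qed.

(** * Following a curve *)

(** Close to an endpoint the boundary distance is that of the endpoint up to the
    length travelled; far from both, the cone condition bounds it from below by
    that length. *)
Lemma link_far_from_removed s u v r z l1 l2 : G u -> G v -> G z ->
  r <= bdist G u -> r <= bdist G v -> last u s = v ->
  onpoly u s z l1 l2 -> Num.min l1 l2 <= 48 * bdist G z -> r <= 49 * bdist G z.
Proof.
move=> Gu Gv Gz ru rv lasts zs.
have h1 := onpoly_dist_start zs; have h2 := onpoly_dist_end zs.
have h3 := bdist_lip open_removal removal_neqT Gu Gz.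
have h4 := bdist_lip open_removal removal_neqT Gv Gz.
rewrite lasts in h2; rewrite (distrC u z) in h3.
by rewrite ge_min => /orP[h|h]; lra.
Qed.

Lemma hop x y u v : D x -> D y -> `|x - y| <= d x / 8000 ->
  well_placed x u -> well_placed y v ->
  `|u - v| <= d x / 1000 /\
  exists s, [/\ last u s = v, plen u s <= 48 * `|u - v| &
    forall z l1 l2, onpoly u s z l1 l2 -> G z /\ d x / 5000 <= 49 * bdist G z].
Proof.
move=> Dx Dy xy [xu Gu du] [yv Gv dv].
have dx := bdist_gt0 (sp_open H) (sp_neqT H) Dx.
have dxy := bdist_lip (sp_open H) (sp_neqT H) Dx Dy.
have := bdist_lip (sp_open H) (sp_neqT H) Dy Dx.
rewrite distrC => dyx.
have xv : `|x - v| <= d x / 2500.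
  by have := ler_distD y x v; clear -H xy yv dyx dx; lra.
have uv : `|u - v| <= d x / 1000.
  by have := ler_distD x u v; rewrite [`|u - x|]distrC; clear -H xv xu dx; lra.
split=> //.
have [||s [lasts len cone]] := local_link Dx Gu Gv.
- by clear -H xu dx; lra.
- by clear -H xv dx; lra.
have du' : d x / 5000 <= bdist G u by clear -H du dx; lra.
have dv' : d x / 5000 <= bdist G v by clear -H dv dx xy dxy; lra.
exists s; split => // z l1 l2 zs; have [Gz min48] := cone z l1 l2 zs.
by split=> //; exact: link_far_from_removed Gu Gv Gz du' dv' lasts zs min48.
Qed.

Lemma bdist_curve_min (a b : R) (g : R -> E) : a <= b ->
  {within `[a, b], continuous g} -> g @` `[a, b] `<=` D ->
  exists2 m, 0 < m & forall t, a <= t <= b -> m <= d (g t).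
Proof.
move=> ab cg gD.
have Dg t : a <= t <= b -> D (g t) by move=> tab; apply: gD; exists t; rewrite //= in_itv.
have cd : {within `[a, b], continuous (d \o g)}.
  apply/subspace_continuousP => t tab; apply/cvgrPdist_lt => e e0.
  move/subspace_continuousP/(_ t tab)/cvgrPdist_lt/(_ e e0) : cg.
  rewrite !near_withinE; apply: filterS => u gtu uab.
  have {gtu} : `|g t - g u| < e by exact: gtu.
  change (`|g t - g u| < e -> `|d (g t) - d (g u)| < e).
  move: tab uab; rewrite /= !in_itv /= => /Dg Dt /Dg Du gtu.
  have h1 := bdist_lip (sp_open H) (sp_neqT H) Dt Du.
  have h2 := bdist_lip (sp_open H) (sp_neqT H) Du Dt.
  by rewrite distrC in h2; rewrite ltr_norml; apply/andP; split; clear -H h1 h2 gtu; lra.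
have [t0 t0ab mint] := EVT_min ab cd.
exists (d (g t0)).
  apply: (bdist_gt0 (sp_open H) (sp_neqT H)); apply: Dg.
  by move: t0ab; rewrite in_itv.
by move=> t tab; apply: mint; rewrite in_itv.
Qed.

(** One hop covers a chord of length exactly [d (g t) / 8000], found by the
    intermediate value theorem, so the vertices at its ends are at most 8 times
    that chord apart and the link between them costs at most [48 * 8 = 384] times
    the length of curve covered.  Every hop uses up at least [m / 8000] of length,
    with [m] the minimum of [d] on the curve, whence the induction.  The last hop
    may cover less than that and accounts for the term [2 * d (g b)]. *)
Lemma chain (a b : R) (g : R -> E) (len : R -> R -> R) v :
  {within `[a, b], continuous g} -> g @` `[a, b] `<=` D ->
  (forall t t', a <= t -> t <= t' -> t' <= b -> `|g t' - g t| <= len t t') ->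
  (forall t t' t'', a <= t -> t <= t' -> t' <= t'' -> t'' <= b ->
     len t t' + len t' t'' <= len t t'') ->
  well_placed (g b) v ->
  forall t u, a <= t -> t <= b -> well_placed (g t) u ->
  exists s, [/\ last u s = v, plen u s <= 384 * len t b + 2 * d (g b) &
    forall z l1 l2, onpoly u s z l1 l2 -> G z /\ exists tau, [/\ t <= tau <= b,
      d (g tau) / 5000 <= 49 * bdist G z,
      l1 <= 384 * len t tau + d (g tau) &
      l2 <= 384 * len tau b + 2 * d (g b)]].
Proof.
move=> cg gD chord add wpv t u at_ tb.
have [m m0 mind] := bdist_curve_min (le_trans at_ tb) cg gD.
have Dg t' : a <= t' -> t' <= b -> D (g t').
  by move=> h1 h2; apply: gD; exists t'; rewrite //= in_itv /= h1 h2.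
have len0 t' t'' : a <= t' -> t' <= t'' -> t'' <= b -> 0 <= len t' t''.
  by move=> h1 h2 h3; rewrite (le_trans _ (chord t' t'' _ _ _)).
have e0 : 0 < m / 8000 by clear -H m0; lra.
have [n] : exists n : nat, len t b < n%:R * (m / 8000).
  exists (Num.bound (len t b / (m / 8000))).
  rewrite -ltr_pdivrMr; last exact: e0.
  by apply: archi_boundP; apply: divr_ge0 (ltW e0); exact: len0.
elim: n t u at_ tb => [|n IH] t u at_ tb ltn wpu.
  by have := len0 _ _ at_ tb (lexx b); rewrite leNgt; rewrite mul0r in ltn; rewrite ltn.
have Dt := Dg _ at_ tb; have dt := bdist_gt0 (sp_open H) (sp_neqT H) Dt.
have Dbb := Dg _ (le_trans at_ tb) (lexx b).
have [[t1 [tt1 t1b far]]|nofar] := pselect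
    (exists t1, [/\ t <= t1, t1 <= b & d (g t) / 8000 <= `|g t1 - g t|]).
  have [|||t' t'I gt'] := @IVT R (fun t' => `|g t' - g t|) t t1 (d (g t) / 8000).
  - exact: tt1.
  - have cg' : {within `[t, t1], continuous g}.
      apply: continuous_subspaceW cg => w /=; rewrite !in_itv /= => /andP[h1 h2].
      by rewrite (le_trans at_ h1) (le_trans h2 t1b).
    move=> w; apply: cvg_norm; apply: cvgB; first exact: cg'.
    exact: cvg_cst.
  - rewrite subrr normr0 ge_min le_max far orbT andbT.
    by apply/orP; left; clear -H dt; lra.
  move: t'I; rewrite in_itv /= => /andP[tt' t't1].
  have t'b := le_trans t't1 t1b; have at' := le_trans at_ tt'.
  have [u' wpu'] := well_placed_exists (Dg _ at' t'b).
  have [|uu' [s1 [last1 len1 cone1]]] := hop Dt (Dg _ at' t'b) _ wpu wpu'.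
    by rewrite distrC gt'.
  have step := chord _ _ at_ tt' t'b.
  have addb := add _ _ _ at_ tt' t'b (lexx b).
  have m_dt := mind t ltac:(by rewrite at_ tb).
  have [|s2 [last2 len2 cone2]] := IH t' u' at' t'b _ wpu'.
    by move: ltn; rewrite -natr1 mulrDl mul1r; clear -H addb step gt' m_dt; lra.
  have len1' : plen u s1 <= 384 * len t t' by clear -H len1 uu' step gt'; lra.
  exists (s1 ++ s2); split.
  - by rewrite last_cat last1.
  - by rewrite plen_cat last1; clear -H len1' len2 addb; lra.
  move=> z l1 l2 /onpoly_cat; rewrite last1 => -[[l zs1 ->]|[l zs2 ->]].
    have [Gz dz] := cone1 _ _ _ zs1; split => //; exists t.
    have [l10 l0 l1l] := onpoly_len zs1.
    have := len0 _ _ at_ (lexx t) tb => ltt.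
    split; rewrite ?lexx //.
      by clear -H ltt l0 l1l len1 uu' dt; lra.
    by clear -H len1' len2 addb l10 l1l; lra.
  have [Gz [tau [/andP[taul taur] dz hl1 hl2]]] := cone2 _ _ _ zs2; split => //.
  exists tau; split => //; first by rewrite (le_trans tt').
  have := add _ _ _ at_ tt' taul taur; clear -H hl1 len1'; lra.
have tb_near : `|g t - g b| <= d (g t) / 8000.
  rewrite leNgt; apply/negP => h; apply: nofar; exists b; split => //.
  by rewrite distrC; exact: ltW.
have dtb := bdist_lip (sp_open H) (sp_neqT H) Dt Dbb.
have [uv [s1 [last1 len1 cone1]]] := hop Dt Dbb tb_near wpu wpv.
have ltb := len0 _ _ at_ tb (lexx b).
exists s1; split => //; first by clear -H len1 uv dtb tb_near ltb dt; lra.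
move=> z l1 l2 zs1; have [Gz dz] := cone1 _ _ _ zs1; split => //; exists t.
have [l10 l20 l1l] := onpoly_len zs1.
have := len0 _ _ at_ (lexx t) tb => ltt.
split; rewrite ?lexx //.
  by clear -H ltt l20 l1l len1 uv dt; lra.
by clear -H l1l l10 len1 uv dtb tb_near ltb dt; lra.
Qed.

(** * From curves in the domain to uniformity of the complement of the sparse set *)

(** A link from [z] to a well placed [u]: if the part before [w] is too long for
    the cone condition, the part after it is short, so the boundary distance at
    [w] is comparable with [d y], which bounds the whole link. *)
Lemma link_endpoint s y z u w l1 l2 : G u -> G w -> G z -> d y / 4000 <= bdist G u ->
  onpoly z s w l1 l2 -> last z s = u -> plen z s <= d y ->
  Num.min l1 l2 <= 48 * bdist G w -> l1 <= 4000 * (49 * bdist G w).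
Proof.
move=> Gu Gw Gz du ws lasts len.
have [l10 l20 l12] := onpoly_len ws.
have := onpoly_dist_end ws; rewrite lasts => uw.
have := bdist_lip open_removal removal_neqT Gu Gw => uw'.
rewrite ge_min => /orP[h|h]; last by clear -H h l12 len l20 uw uw' du; lra.
by clear -H h l10; lra.
Qed.

Lemma link_startpoint s y z u w l1 l2 : G u -> G w -> G z -> d y / 4000 <= bdist G u ->
  onpoly u s w l1 l2 -> last u s = z -> plen u s <= d y ->
  Num.min l1 l2 <= 48 * bdist G w -> l2 <= 4000 * (49 * bdist G w).
Proof.
move=> Gu Gw Gz du ws lasts len.
have [l10 l20 l12] := onpoly_len ws.
have := onpoly_dist_start ws; rewrite distrC => uw.
have := bdist_lip open_removal removal_neqT Gu Gw => uw'.
rewrite ge_min => /orP[h|h]; first by clear -H h l12 len l10 uw uw' du; lra.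
by clear -H h l20; lra.
Qed.

(** The endpoints may be displaced so that curves joining points of a dense subset
    suffice. *)
Definition near_curve (c : R) z1 z2 := exists y1 y2 a b g,
  [/\ rectifiable_arc D y1 y2 a b g,
      `|y1 - z1| <= d y1 / 4000 /\ `|y2 - z2| <= d y2 / 4000,
      forall t, t \in `[a, b] ->
        (mine (arclength a t g) (arclength t b g) <= (c * d (g t))%:E)%E &
      (arclength a b g <= (c * `|y1 - y2|)%:E)%E].

(** A link from [z1], a chain along the curve and a link to [z2].  As [z1] and [z2]
    are far apart, the lengths [d y1] and [d y2] lost near the endpoints are
    absorbed by [`|z1 - z2|].  In the cone condition at a point near [g tau] they
    are absorbed by the distance along the curve plus [d (g tau)], as [d] is
    1-Lipschitz. *)
Lemma polygon_near_curve c z1 z2 : 1 <= c -> G z1 -> G z2 -> near_curve c z1 z2 ->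
  d z1 / 2000 < `|z1 - z2| ->
  exists s, [/\ last z1 s = z2, plen z1 s <= 9 * 4000 * (c * `|z1 - z2|) &
    forall z l1 l2, onpoly z1 s z l1 l2 ->
      G z /\ Num.min l1 l2 <= 390 * 5000 * (49 * (c * bdist G z))].
Proof.
move=> c1 Gz1 Gz2 [y1 [y2 [a [b [g [[ab cg _ gD [ga gb fin]] [yz1 yz2] cone leng]]]]]] far.
have fin_sub t t' : a <= t -> t <= t' -> t' <= b -> arclength t t' g \is a fin_num.
  move=> h1 h2 h3; rewrite ge0_fin_numE ?arclength_ge0 //.
  apply: le_lt_trans fin; apply: (le_trans (arclength_monol g h2 h3)).
  exact: (arclength_monor g h1 (le_trans h2 h3)).
pose len t t' := fine (arclength t t' g).
have lenE t t' : a <= t -> t <= t' -> t' <= b -> arclength t t' g = (len t t')%:E.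
  by move=> h1 h2 h3; rewrite /len fineK // fin_sub.
have chord t t' : a <= t -> t <= t' -> t' <= b -> `|g t' - g t| <= len t t'.
  by move=> h1 h2 h3; rewrite -lee_fin -lenE // chord_le_arclength.
have add t t' t'' : a <= t -> t <= t' -> t' <= t'' -> t'' <= b ->
    len t t' + len t' t'' <= len t t''.
  move=> h1 h2 h3 h4; rewrite -lee_fin EFinD -!lenE ?arclength_superadditive //.
  - by rewrite (le_trans h2).
  - by rewrite (le_trans h1).
  - by rewrite (le_trans h3).
have Dg t : a <= t -> t <= b -> D (g t).
  by move=> h1 h2; apply: gD; exists t; rewrite //= in_itv /= h1 h2.
have Dy1 : D y1 by rewrite -ga; exact: Dg.
have Dy2 : D y2 by rewrite -gb; exact: Dg.
have d1 := bdist_gt0 (sp_open H) (sp_neqT H) Dy1.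
have d2 := bdist_gt0 (sp_open H) (sp_neqT H) Dy2.
have [u1 wp1] := well_placed_exists Dy1; have [u2 wp2] := well_placed_exists Dy2.
have [yu1 Gu1 bu1] := wp1; have [yu2 Gu2 bu2] := wp2.
have [||s1 [last1 len1 cone1]] := local_link Dy1 Gz1 Gu1.
- by clear -H yz1 d1; lra.
- by clear -H yu1 d1; lra.
have [||s3 [last3 len3 cone3]] := local_link Dy2 Gu2 Gz2.
- by clear -H yu2 d2; lra.
- by clear -H yz2 d2; lra.
have {}len1 : plen z1 s1 <= d y1.
  have := ler_distD y1 z1 u1; rewrite [`|z1 - y1|]distrC.
  by clear -H len1 yz1 yu1 d1; lra.
have {}len3 : plen u2 s3 <= d y2.
  have := ler_distD y2 u2 z2; rewrite [`|u2 - y2|]distrC.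
  by clear -H len3 yz2 yu2 d2; lra.
have [||s2 [last2 len2 cone2]] := chain cg gD chord add (v := u2) _ (lexx a) ab (u := u1).
- by rewrite gb.
- by rewrite ga.
rewrite gb in len2 cone2.
have lenab : len a b <= c * `|y1 - y2| by rewrite -lee_fin -lenE.
have minlen t : a <= t -> t <= b -> Num.min (len a t) (len t b) <= c * d (g t).
  move=> h1 h2; rewrite -lee_fin EFin_min -!lenE //.
  by apply: cone; rewrite in_itv /= h1 h2.
have bG w : G w -> 0 <= bdist G w.
  by move=> Gw; exact: ltW (bdist_gt0 open_removal removal_neqT Gw).
exists (s1 ++ s2 ++ s3); split.
- by rewrite !last_cat last1 last2.
- rewrite !plen_cat last1 last2.
  have y12 : `|y1 - y2| <= `|y1 - z1| + `|z1 - z2| + `|y2 - z2|.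
    have h1 := ler_distD z1 y1 y2; have h2 := ler_distD z2 z1 y2.
    by rewrite (distrC z2 y2) in h2; clear -H h1 h2; lra.
  have e1 := bdist_lip (sp_open H) (sp_neqT H) Dy1 Gz1.1.
  have e2 := bdist_lip (sp_open H) (sp_neqT H) Dy2 Gz2.1.
  have e3 := bdist_lip (sp_open H) (sp_neqT H) Gz2.1 Gz1.1.
  rewrite (distrC z2 z1) in e3.
  have f1 : d y1 / 4000 <= 2 * `|z1 - z2| by clear -H e1 yz1 far d1; lra.
  have f2 : d y2 / 4000 <= 2 * `|z1 - z2| by clear -H e2 e3 yz2 far d2; lra.
  have f3 : `|y1 - y2| <= 5 * `|z1 - z2| by clear -H y12 f1 f2 yz1 yz2; lra.
  have f4 : len a b <= 5 * (c * `|z1 - z2|).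
    apply: le_trans lenab _; rewrite mulrCA ler_pM2l //.
    by rewrite (lt_le_trans ltr01).
  have f5 : `|z1 - z2| <= c * `|z1 - z2| by rewrite ler_peMl.
  have f6 := normr_ge0 (z1 - z2).
  by clear -H len1 len2 len3 f1 f2 f4 f5 f6; lra.
move=> z l1 l2 /onpoly_cat; rewrite last1 => -[[l zs1 _]|[l + ->]].
  have [Gz m1] := cone1 _ _ _ zs1; split => //.
  have := link_endpoint Gu1 Gz Gz1 bu1 zs1 last1 len1 m1.
  have : bdist G z <= c * bdist G z by rewrite ler_peMl // bG.
  have := bG z Gz; rewrite ge_min; clear -H => h1 h2 h3; apply/orP; left; lra.
move=> /onpoly_cat; rewrite last2 => -[[l' zs2 ->]|[l' zs3 _]]; last first.
  have [Gz m3] := cone3 _ _ _ zs3; split => //.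
  have := link_startpoint Gu2 Gz Gz2 bu2 zs3 last3 len3 m3.
  have : bdist G z <= c * bdist G z by rewrite ler_peMl // bG.
  have := bG z Gz; rewrite ge_min; clear -H => h1 h2 h3; apply/orP; right; lra.
have [Gz [tau [/andP[atau taub] dtau hl1 hl2]]] := cone2 _ _ _ zs2; split => //.
have Dtau := Dg _ atau taub.
have e1 := bdist_lip (sp_open H) (sp_neqT H) Dy1 Dtau.
have e2 := bdist_lip (sp_open H) (sp_neqT H) Dy2 Dtau.
have c_1 := chord _ _ (lexx a) atau taub; have c_2 := chord _ _ atau taub (lexx b).
rewrite ga distrC in c_1; rewrite gb in c_2.
have dtau0 := bdist_gt0 (sp_open H) (sp_neqT H) Dtau.
have dc : d (g tau) <= c * d (g tau) by rewrite ler_peMl // ltW.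
have cb : c * (d (g tau) / 5000) <= 49 * (c * bdist G z).
  by rewrite [leRHS]mulrCA ler_pM2l // (lt_le_trans ltr01).
rewrite mulrA in cb.
have := minlen tau atau taub; rewrite !ge_min => /orP[h|h]; apply/orP.
  by left; clear -H h hl1 len1 e1 c_1 dc cb dtau0; lra.
by right; clear -H h hl2 len3 e2 c_2 dc cb dtau0; lra.
Qed.

(** Erasing loops turns the polygons into arcs; connectedness of [G] follows, as
    [G] is the union of arcs issuing from one point. *)
Lemma polygons_uniform (K : R) : D !=set0 ->
  (forall z1 z2, G z1 -> G z2 -> exists s, [/\ last z1 s = z2,
    plen z1 s <= K * `|z1 - z2| &
    forall z l1 l2, onpoly z1 s z l1 l2 -> G z /\ Num.min l1 l2 <= K * bdist G z]) ->
  uniform_domain K G.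
Proof.
move=> [x0 Dx0] poly.
have arcs z1 z2 : G z1 -> G z2 -> exists a b g,
      [/\ rectifiable_arc G z1 z2 a b g,
          forall t, t \in `[a, b] ->
            (mine (arclength a t g) (arclength t b g)
               <= (K * bdist G (g t))%:E)%E &
          (arclength a b g <= (K * `|z1 - z2|)%:E)%E].
  move=> Gz1 Gz2; have [s [lasts len cone]] := poly z1 z2 Gz1 Gz2.
  have [|a [b [g [arc leng arcs]]]] := @polygon_arc _ _ z1 s G.
    by move=> z l1 l2 /cone[].
  exists a, b, g; rewrite -lasts; split => //.
    move=> t /arcs[l1 [l2 [/cone[_ m] q1 q2]]].
    apply: (@le_trans _ _ (Num.min l1 l2)%:E); last by rewrite lee_fin.
    by rewrite EFin_min le_min !ge_min q1 q2 orbT.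
  by rewrite (le_trans leng) // lee_fin lasts.
split => //.
have [u0 [_ Gu0 _]] := well_placed_exists Dx0.
split; [by exists u0|exact: open_removal| |exact: removal_neqT].
have chosen z : exists C : set E, G z -> [/\ connected C, C u0, C z & C `<=` G].
  have [Gz|nGz] := pselect (G z); last by exists set0.
  have [a [b [g [[ab cg _ gG [ga gb _]] _ _]]]] := arcs u0 z Gu0 Gz.
  exists (g @` `[a, b]) => _; split => //.
  - by apply: connected_continuous_connected cg; exact: segment_connected.
  - by exists a; rewrite //= in_itv /= lexx ab.
  - by exists b; rewrite //= in_itv /= lexx ab.
have [C CP] := choice chosen.
have -> : G = \bigcup_(z in G) C z.
  apply/seteqP; split => z; first by move=> Gz; exists z => //; have [] := CP z Gz.
  by move=> [w Gw Cz]; have [_ _ _ sub] := CP w Gw; exact: sub.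
apply: bigcup_connected; first by exists u0 => z /CP[].
by move=> z /CP[].
Qed.

Lemma uniform_of_near_curves c : 1 <= c -> D !=set0 ->
  (forall z1 z2, G z1 -> G z2 -> near_curve c z1 z2) ->
  uniform_domain (390 * 5000 * (49 * c)) G.
Proof.
move=> c1 Dne curves; apply: polygons_uniform => // z1 z2 Gz1 Gz2.
have bG w : G w -> bdist G w <= c * bdist G w.
  move=> Gw; rewrite ler_peMl //; exact: ltW (bdist_gt0 open_removal removal_neqT Gw).
have dc : `|z1 - z2| <= c * `|z1 - z2| by rewrite ler_peMl.
have zz := normr_ge0 (z1 - z2).
have [near|far] := leP `|z1 - z2| (d z1 / 2000).
  have d1 := bdist_gt0 (sp_open H) (sp_neqT H) Gz1.1.
  have [|s [lasts len cone]] := local_link Gz1.1 Gz1 Gz2 _ near.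
    by rewrite subrr normr0; clear -H d1; lra.
  exists s; split => //; first by clear -H len dc zz; lra.
  move=> z l1 l2 /cone[Gz m]; split => //; have := bG z Gz.
  have := bdist_gt0 open_removal removal_neqT Gz.
  by clear -H m; lra.
have [s [lasts len cone]] := polygon_near_curve c1 Gz1 Gz2 (curves z1 z2 Gz1 Gz2) far.
exists s; split => //; first by clear -H len dc zz; lra.
by move=> z l1 l2 /cone[Gz m]; split => //; clear -H m; lra.
Qed.

End SparseRemoval.

(** * Quasihyperbolic separation and density *)
Section Separation.
Context {R : realType} {E : completeNormedModType R}.
Implicit Types (D P U : set E) (x y z : E).

(** The integral of a nonnegative function is a supremum over the simple functions
    below it, so the bound holds without measurability, which is not clear for
    densities composed with [arclength_param]. *)
Lemma integral_le_cst (L M : R) (f : R -> R) : 0 <= L -> 0 <= M ->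
  (forall s, 0 <= s <= L -> 0 <= f s <= M) ->
  (\int[lebesgue_measure]_(s in `[0%R, L]) (f s)%:E <= (M * L)%:E)%E.
Proof.
move=> L0 M0 fM.
have fM' s : `[0, L]%classic s -> 0 <= f s <= M by rewrite /= in_itv; exact: fM.
have -> : (M * L)%:E = (\int[lebesgue_measure]_(s in `[0%R, L]) M%:E)%E.
  rewrite integral_cst //= lebesgue_measure_itv /= lte_fin.
  by case: ltgtP L0 => // [_|<-] _; rewrite ?subr0 -EFinM ?mulr0 // oppr0 addr0.
rewrite !ge0_integralE //; last by move=> s /fM' /andP[f0 _]; rewrite lee_fin.
apply: le_ereal_sup => _ [h hf <-]; exists h => // s.
apply: le_trans (hf s) _; rewrite /patch; case: ifPn => // /set_mem /fM' /andP[_ fs].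
by rewrite lee_fin.
Qed.

(** On the segment the density is at most [4 / (3 * bdist U x)] and the length is
    less than [bdist U x / 4], so the quasihyperbolic length is less than [1 / 3]. *)
Lemma qh_dist_segment U x y : open U -> U != [set: E] -> U x -> x <> y ->
  4 * `|x - y| < bdist U x -> (qh_dist U x y < (2^-1 : R)%:E)%E.
Proof.
move=> oU UT Ux /eqP xy near.
have dx := bdist_gt0 oU UT Ux.
have Useg z l1 l2 : onpoly x [:: y] z l1 l2 -> U z /\ 3 * bdist U x <= 4 * bdist U z.
  move=> zs; have [_ l20] := onpoly_len zs; rewrite /= addr0 => l12.
  have := onpoly_dist_start zs; rewrite distrC => xz.
  have [|Uz dz] := bdist_near oU UT Ux xz; first by rewrite distrC in l12; lra.
  by split => //; rewrite distrC in l12; lra.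
have [|a [b [g [arc len gs]]]] := @polygon_arc _ _ x [:: y] U.
  by move=> z l1 l2 /Useg[].
have [ab _ _ _ [_ _ fin]] := arc.
set L := arclength a b g in len fin.
have L0 : 0 <= fine L by rewrite fine_ge0 // arclength_ge0.
have Lfin : L \is a fin_num by rewrite ge0_fin_numE ?arclength_ge0.
have Lxy : fine L <= `|x - y|.
  by rewrite -lee_fin fineK // (le_trans len) //= addr0 distrC.
have dg t : t \in `[a, b] -> U (g t) /\ 3 * bdist U x <= 4 * bdist U (g t).
  by move=> /gs[l1 [l2 [/Useg]]].
have dp s : 0 <= (bdist U (arclength_param a b g s))^-1 <= 4 / (3 * bdist U x).
  (* also when no point of the curve is at length s, by the default value g a *)
  have [t tab ->] : exists2 t, t \in `[a, b] & arclength_param a b g s = g t.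
    rewrite /arclength_param; case: xgetP => [z _ [t tab [_ <-]]|_]; first by exists t.
    by exists a; rewrite // in_itv /= lexx ab.
  have [Ugt dgt] := dg t tab; have d0 := bdist_gt0 oU UT Ugt.
  rewrite invr_ge0 ltW //= -[leLHS]mul1r ler_pdivrMr // mulrAC ler_pdivlMr ?mul1r //.
  by rewrite mulr_gt0.
apply: (@le_lt_trans _ _ (line_integral (fun z => (bdist U z)^-1) a b g)).
  by apply: ereal_inf_lbound; exists a, b, g; split.
apply: (@le_lt_trans _ _ (4 / (3 * bdist U x) * fine L)%:E).
  by apply: integral_le_cst => //; rewrite divr_ge0 // mulr_ge0 // ltW.
rewrite lte_fin mulrAC ltr_pdivrMr ?mulr_gt0 //; lra.
Qed.

(** A segment issuing from [z] is uncountable. *)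
Lemma countable_not_near D P z r : dim_ge2 E -> countable P -> open D -> D z ->
  0 < r -> exists2 y, (D `\` P) y & `|z - y| <= r.
Proof.
move=> dimE cP oD Dz r0; have [e e0 eD] := open_normP oD Dz.
pose k := Num.min r (e / 2).
have k0 : 0 < k by rewrite lt_min r0 divr_gt0.
have kr : k <= r by rewrite ge_min lexx.
have ke : k <= e / 2 by rewrite ge_min lexx orbT.
have [v vk] := norm_surjective dimE (ltW k0).
have vz : v != 0 by rewrite -normr_eq0 vk gt_eqF.
have zv : z != z + v by rewrite -subr_eq0 opprD addrA subrr add0r oppr_eq0.
have dz t : 0 <= t <= 1 -> `|z - seg z (z + v) t| <= k.
  move=> /andP[t0 t1]; have := seg_dist z (z + v) 0 t.
  rewrite seg0 distrC => ->.
  by rewrite subr0 addrC addKr vk ger0_norm // ler_piMl // ltW.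
apply: contrapT => none.
have subP : seg z (z + v) @` `[0, 1] `<=` P.
  move=> _ [t tI <-]; have t01 : 0 <= t <= 1 by move: tI; rewrite /= in_itv.
  apply: contrapT => nP; have zt := dz t t01; apply: none.
  exists (seg z (z + v) t); last exact: le_trans kr.
  by split => //; apply: eD; lra.
have c01 : countable (`[0, 1] : set R).
  have inj : {in `[0, 1]%classic &, injective (seg z (z + v))}.
    by move=> t u _ _; exact: seg_inj.
  by rewrite -(eq_countable (inj_card_eq inj)) (sub_countable (subset_card_le subP)).
have := countable_lebesgue_measure0 c01.
rewrite lebesgue_measure_itv /= lte_fin ltr01 sube0 => /eqP.
by rewrite eqe oner_eq0.
Qed.

End Separation.

(** * The theorem *)
Section NearCurves.
Context {R : realType} {E : completeNormedModType R}.
Implicit Types (D P G : set E) (c : R).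

Lemma sparse_of_qh_separated D P : dim_ge2 E -> proper_domain D -> P `<=` D ->
  relatively_closed D P ->
  (forall x y : E, P x -> P y -> x <> y -> ((2^-1 : R)%:E <= qh_dist D x y)%E) ->
  sparse_in D P.
Proof.
move=> dimE [_ oD _ DT] PD cP sep; split => // p q Pp Pq pq.
rewrite leNgt; apply/negP => near.
have := qh_dist_segment oD DT (PD p Pp) pq near.
by rewrite ltNge sep.
Qed.

Lemma sparse_set0 D : dim_ge2 E -> proper_domain D -> sparse_in D set0.
Proof.
move=> dimE [_ oD _ DT]; split => //.
by exists set0; [exact: closed0|rewrite setI0].
Qed.

Lemma near_curve_of_uniform D G c z1 z2 y1 y2 : proper_domain D -> G `<=` D ->
  uniform_domain c G -> G y1 -> G y2 ->
  `|y1 - z1| <= bdist D y1 / 4000 -> `|y2 - z2| <= bdist D y2 / 4000 ->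
  near_curve (D := D) (1 + `|c|) z1 z2.
Proof.
move=> [_ oD _ DT] GD [[_ oG _ GT] unif] Gy1 Gy2 yz1 yz2.
have [a [b [g [[ab cg ig gG ends] cone len]]]] := unif y1 y2 Gy1 Gy2.
have cc : c <= 1 + `|c| by have := ler_norm c; lra.
have c0 : 0 <= 1 + `|c| by have := normr_ge0 c; lra.
exists y1, y2, a, b, g; split => //.
- by split => //; exact: subset_trans GD.
- move=> t tab; apply: le_trans (cone t tab) _; rewrite lee_fin.
  have Gt : G (g t) by apply: gG; exists t.
  have dG := bdist_gt0 oG GT Gt.
  apply: (@le_trans _ _ ((1 + `|c|) * bdist G (g t))); first by rewrite ler_wpM2r // ltW.
  by rewrite ler_wpM2l // bdist_sub.
- by apply: le_trans len _; rewrite lee_fin ler_wpM2r.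
Qed.

End NearCurves.

Theorem corollary1 (R : realType) :
  (forall c : R, exists c1 : R,
     forall (E : completeNormedModType R) (D P : set E),
       dim_ge2 E -> proper_domain D ->
       P `<=` D -> countable P -> relatively_closed D P ->
       (forall x y : E, P x -> P y -> x <> y ->
          ((2^-1 : R)%:E <= qh_dist D x y)%E) ->
       uniform_domain c D -> uniform_domain c1 (D `\` P))
  /\
  (forall c1 : R, exists c : R,
     forall (E : completeNormedModType R) (D P : set E),
       dim_ge2 E -> proper_domain D ->
       P `<=` D -> countable P -> relatively_closed D P ->
       (forall x y : E, P x -> P y -> x <> y ->
          ((2^-1 : R)%:E <= qh_dist D x y)%E) ->
       uniform_domain c1 (D `\` P) -> uniform_domain c D).
Proof.
split=> c; exists (390 * 5000 * (49 * (1 + `|c|))) => E D P dimE pD PD cP clP sep unif;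
  have [Dne oD _ DT] := pD; have c1 : 1 <= 1 + `|c| by rewrite lerDl.
  have H := sparse_of_qh_separated dimE pD PD clP sep.
  apply: (uniform_of_near_curves H c1 Dne) => z1 z2 [Dz1 _] [Dz2 _].
  have self z : D z -> `|z - z| <= bdist D z / 4000.
    by move=> Dz; rewrite subrr normr0; have := bdist_gt0 oD DT Dz; lra.
  exact: (near_curve_of_uniform pD _ unif Dz1 Dz2 (self _ Dz1) (self _ Dz2)).
have H := sparse_set0 dimE pD.
rewrite -(setD0 D); apply: (uniform_of_near_curves H c1 Dne).
have approx z : D z -> exists2 y, (D `\` P) y & `|y - z| <= bdist D y / 4000.
  move=> Dz; have dz := bdist_gt0 oD DT Dz.
  have dz' : 0 < bdist D z / 5000 by lra.
  have [y Gy zy] := countable_not_near dimE cP oD Dz dz'.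
  exists y; first exact: Gy.
  have := bdist_lip oD DT Dz Gy.1; rewrite (distrC y z); clear -zy dz; lra.
move=> z1 z2 [/approx[y1 Gy1 yz1] _] [/approx[y2 Gy2 yz2] _].
apply: (near_curve_of_uniform pD _ unif Gy1 Gy2 yz1 yz2).
by move=> z [].
Qed.
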